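(* Let $I\subset\mathbb{R}$ be an interval and let $\Omega\subset\mathbb{R}^n$ be a bounded domain. Let $G_{\rm N}=G_{\rm N}(x,y,a,b)$ be a function with $G_{\rm N}(x,y,a,b)=G_{\rm N}(y,x,b,a)$ satisfying the ellipticity condition $\partial^2_{ab}G_{\rm N}(x,y,a,b)\le 0$. Let $\{u^t\}_{t\in I}$ be a field in $\mathbb{R}^n$ which is sufficiently regular for $G_{\rm N}$, and let $t(x,\lambda)$ be its leaf-parameter function, defined on $$\mathcal{G}=\{(x,\lambda)\in\mathbb{R}^n\times\mathbb{R}:\ \lambda=u^t(x)\text{ for some }t\in I\}.$$ Given $t_0\in I$, let $$\mathcal{E}_{\rm N}(w)=\frac12\iint_{Q(\Omega)}G_{\rm N}(x,y,w(x),w(y))\,dx\,dy$$ and $$\mathcal{C}_{\rm N}(w)=\iint_{Q(\Omega)}\int_{u^{t_0}(x)}^{w(x)}\partial_aG_{\rm N}(x,y,u^t(x),u^t(y))\Big|_{t=t(x,\lambda)}\,d\lambda\,dx\,dy+\mathcal{E}_{\rm N}(u^{t_0}),$$ defined for $w$ in a set $\mathcal{A}_{\rm N}$ of sufficiently regular (for $G_{\rm N}$) admissible functions $w:\mathbb{R}^n\to\mathbb{R}$ with $\operatorname{graph} w\subset\mathcal{G}$. Then: (a) $\mathcal{C}_{\rm N}(u^{t_0})=\mathcal{E}_{\rm N}(u^{t_0})$, and $\mathcal{C}_{\rm N}(w)\le\mathcal{E}_{\rm N}(w)$ for all $w\in\mathcal{A}_{\rm N}$ with $w\equiv u^{t_0}$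 in $\Omega^c$. (b) Assume in addition that $\mathcal{L}_{\rm N}(u^t)\ge0$ in $\Omega$ for $t\ge t_0$ and $\mathcal{L}_{\rm N}(u^t)\le0$ in $\Omega$ for $t\le t_0$ ($t \in I$). Then $\mathcal{C}_{\rm N}(u^{t_0})\le\mathcal{C}_{\rm N}(w)$ for all $w\in\mathcal{A}_{\rm N}$ with $w\equiv u^{t_0}$ in $\Omega^c$. In particular, $\mathcal{C}_{\rm N}$ is a calibration for $\mathcal{E}_{\rm N}$ and $u^{t_0}$, and hence $u^{t_0}$ minimizes $\mathcal{E}_{\rm N}$ among functions $w\in\mathcal{A}_{\rm N}$ such that $w\equiv u^{t_0}$ in $\Omega^c$. (c) Assume in addition that $\{u^t\}_{t\in I}$ is a field of extremals in $\Omega$, i.e. $\mathcal{L}_{\rm N}(u^t)=0$ in $\Omega$ for all $t\in I$. Then $\mathcal{C}_{\rm N}(u^{t_0})=\mathcal{C}_{\rm N}(w)$ for all $w\in\mathcal{A}_{\rm N}$ with $w\equiv u^{t_0}$ in $\Omega^c$. Therefore $\mathcal{C}_{\rm N}$ is a null-Lagrangian for $\mathcal{E}_{\rm N}$ and $u^{t_0}$. As a consequence, for every $t\in I$, the extremal $u^t$ minimizes $\mathcal{E}_{\rm N}$ among functions $w\in\mathcal{A}_{\rm N}$ such that $w\equiv u^t$ in $\Omega^c$.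
   Context: Notation: $\Omega^c=\mathbb{R}^n\setminus\Omega$ and $Q(\Omega)=(\mathbb{R}^n\times\mathbb{R}^n)\setminus(\Omega^c\times\Omega^c)$. $\partial_a$, $\partial_b$ denote the partial derivatives of $G_{\rm N}(x,y,a,b)$ in its third and fourth arguments. Field: a family $\{u^t\}_{t\in I}$ of functions $u^t:\mathbb{R}^n\to\mathbb{R}$ is a field in $\mathbb{R}^n$ if $(x,t)\mapsto u^t(x)$ is continuous in $\mathbb{R}^n\times I$ and, for each $x\in\mathbb{R}^n$, $t\mapsto u^t(x)$ is $C^1$ and (strictly) increasing in $I$. The interval $I$ need not be bounded nor open. Leaf-parameter function: for $(x,\lambda)\in\mathcal{G}$, $t(x,\lambda)\in I$ is the unique number with $u^{t(x,\lambda)}(x)=\lambda$. Euler-Lagrange operator: $\mathcal{L}_{\rm N}(w)(x)=\int_{\mathbb{R}^n}\partial_aG_{\rm N}(x,y,w(x),w(y))\,dy$ for $x\in\Omega$. Calibration and null-Lagrangian: for a functional $\mathcal{E}:\mathcal{A}\to\mathbb{R}$ and $u\in\mathcal{A}$, a functional $\mathcal{C}:\mathcal{A}\to\mathbb{R}$ is a calibration for $\mathcal{E}$ and $u$ if $\mathcal{C}(u)=\mathcal{E}(u)$ and, for all $w\in\mathcal{A}$ with $w=u$ in $\Omega^c$, $\mathcal{C}(w)\le\mathcal{E}(w)$ and $\mathcal{C}(u)\le\mathcal{C}(w)$. It is a null-Lagrangian if the last condition is replaced by $\mathcal{C}(u)=\mathcal{C}(w)$. Regularity convention: the theorem is stated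 for general $G_{\rm N}$ without fixing growth or regularity classes. ''Sufficiently regular for $G_{\rm N}$'' means that the functions considered (the leaves $u^t$ and the admissible $w$, including the leaves as admissible functions) are such that all integrals involved (the energy, the operator $\mathcal{L}_{\rm N}$, the functional $\mathcal{C}_{\rm N}$ and the integrals obtained from them by changes of variables, symmetrization in $(x,y)$, and splitting) are well defined and convergent and the order of integration may be interchanged. *)

(* Defs.v *)
From HB Require Import structures.
From mathcomp Require Import all_boot all_order all_algebra.
From mathcomp Require Import all_classical all_reals all_analysis.

Set Implicit Arguments.
Unset Strict Implicit.
Unset Printing Implicit Defensive.

Import Order.TTheory GRing.Theory Num.Theory.
Import numFieldNormedType.Exports.

Local Open Scope classical_set_scope.
Local Open Scope ring_scope.

(* Borel structure and Lebesgue measure on R^n = 'rV[R]_n: the sigma-algebra is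
   the one generated by the coordinates (as for n.-tuple in the library), and
   the measure is obtained by iterating the product with the one-dimensional
   Lebesgue measure; [lebesgue_rV_box] checks it on boxes. *)

Definition measure_rV_display : measure_display -> measure_display.
Proof. exact. Qed.

Section measurable_rV.
Context (R : realType) (n : nat).

Let coor : 'I_n -> 'rV[R]_n -> R := fun i x => x ord0 i.

Let rV_set0 : g_sigma_preimage coor set0.
Proof. exact: sigma_algebra0. Qed.

Let rV_setC A : g_sigma_preimage coor A -> g_sigma_preimage coor (~` A).
Proof. exact: sigma_algebraC. Qed.

Let rV_bigcup (F : _^nat) : (forall i, g_sigma_preimage coor (F i)) ->
  g_sigma_preimage coor (\bigcup_i (F i)).
Proof. exact: sigma_algebra_bigcup. Qed.

HB.instance Definition _ := @isMeasurable.Build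
  (measure_rV_display default_measure_display) 'rV[R]_n
  (g_sigma_preimage coor) rV_set0 rV_setC rV_bigcup.

End measurable_rV.

Section lebesgue_rV.
Context (R : realType).

Lemma measurable_coord n (i : 'I_n) :
  measurable_fun [set: 'rV[R]_n] (fun x : 'rV[R]_n => x ord0 i).
Proof.
move=> _ Y mY; rewrite setTI; apply: sub_sigma_algebra => /=.
rewrite -bigcup_seq/=; exists i => /=; first by rewrite mem_index_enum.
by exists Y => //; rewrite setTI.
Qed.

Lemma measurable_fun_coordP d (T : measurableType d) n (f : T -> 'rV[R]_n) :
  measurable_fun [set: T] f <->
  forall i, measurable_fun [set: T] (fun x => f x ord0 i).
Proof.
split=> [mf i|mf].
  exact: (measurableT_comp (measurable_coord i) mf).
move=> _ A; rewrite setTI => mA.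
have mf' : [set B | measurable (f @^-1` B)] A; last exact: mf'.
apply: (mA [set B | measurable (f @^-1` B)]); split.
- split=> /=.
  + by rewrite preimage_set0.
  + by move=> B mB; rewrite setTD preimage_setC; exact: measurableC.
  + by move=> F mF; rewrite preimage_bigcup; exact: bigcupT_measurable.
- move=> B; rewrite -bigcup_seq/= => -[i _ [C mC <-]].
  rewrite setTI -comp_preimage -[X in measurable X]setTI.
  exact: mf.
Qed.

Definition cons_rV n (p : R * 'rV[R]_n) : 'rV[R]_n.+1 := row_mx p.1%:M p.2.

Lemma cons_rV0 n (p : R * 'rV[R]_n) : cons_rV p ord0 ord0 = p.1.
Proof.
rewrite /cons_rV mxE; case: splitP => // j _.
by rewrite (ord1 j) mxE.
Qed.

Lemma cons_rVS n (p : R * 'rV[R]_n) i :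
  cons_rV p ord0 (lift ord0 i) = p.2 ord0 i.
Proof.
rewrite /cons_rV mxE; case: splitP => [j|j /= /eqP].
  by rewrite (ord1 j).
by rewrite eqSS => /eqP/val_inj ->.
Qed.

Lemma measurable_cons_rV n :
  measurable_fun [set: measurableTypeR R * 'rV[R]_n] (@cons_rV n).
Proof.
apply/measurable_fun_coordP => i; case: (unliftP ord0 i) => [j|] ->.
  under eq_fun do rewrite cons_rVS.
  exact: (measurableT_comp (measurable_coord j) measurable_snd).
under eq_fun do rewrite cons_rV0.
exact: measurable_fst.
Qed.

Lemma measurable_behead_rV n :
  measurable_fun [set: 'rV[R]_n.+1]
    (fun x : 'rV[R]_n.+1 => \row_(i < n) x ord0 (lift ord0 i)).
Proof.
apply/measurable_fun_coordP => i; under eq_fun do rewrite mxE.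
exact: measurable_coord.
Qed.

Section step.
Context (n : nat) (m : {sigma_finite_measure set 'rV[R]_n -> \bar R}).

Definition lebesgue_cons : set 'rV[R]_n.+1 -> \bar R :=
  pushforward (@lebesgue_measure R \x m)%E (@cons_rV n).

Let lebesgue_cons0 : lebesgue_cons set0 = 0%E.
Proof. by rewrite /lebesgue_cons /pushforward preimage_set0 measure0. Qed.

Let lebesgue_cons_ge0 A : (0 <= lebesgue_cons A)%E.
Proof. exact: (measure_ge0 (@lebesgue_measure R \x m)%E). Qed.

Let lebesgue_cons_sigma_additive : semi_sigma_additive lebesgue_cons.
Proof.
have mf := @measurable_cons_rV n.
move=> F mF tF mUF; rewrite /lebesgue_cons /pushforward preimage_bigcup.
apply: (@measure_semi_sigma_additive _ _ _ (@lebesgue_measure R \x m)%E).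
- by move=> k; rewrite -[X in measurable X]setTI; exact: mf.
- apply/trivIsetP => /= i j _ _ ij; rewrite -preimage_setI.
  by move/trivIsetP : tF => /(_ _ _ _ _ ij) ->//; rewrite preimage_set0.
- by rewrite -preimage_bigcup -[X in measurable X]setTI; exact: mf.
Qed.

HB.instance Definition _ := isMeasure.Build _ _ _ lebesgue_cons
  lebesgue_cons0 lebesgue_cons_ge0 lebesgue_cons_sigma_additive.

Lemma preimage_cons_rV (A : set R) (B : set 'rV[R]_n) :
  @cons_rV n @^-1` [set x | A (x ord0 ord0) /\
                            B (\row_(i < n) x ord0 (lift ord0 i))] = A `*` B.
Proof.
have rowE (p : R * 'rV[R]_n) :
    \row_(i < n) cons_rV p ord0 (lift ord0 i) = p.2.
  by apply/rowP => i; rewrite mxE cons_rVS.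
by apply/seteqP; split=> p /=; rewrite cons_rV0 rowE.
Qed.

Lemma measurable_cons_rV_setX (A : set R) (B : set 'rV[R]_n) :
  measurable A -> measurable B ->
  measurable [set x : 'rV[R]_n.+1 | A (x ord0 ord0) /\
                            B (\row_(i < n) x ord0 (lift ord0 i))].
Proof.
move=> mA mB; rewrite -[X in measurable X]setTI.
have mA' := @measurable_coord n.+1 ord0 measurableT A mA.
have mB' := @measurable_behead_rV n measurableT B mB.
by have := measurableI _ _ mA' mB'; rewrite !setTI.
Qed.

Lemma lebesgue_cons_setX (A : set R) (B : set 'rV[R]_n) :
  measurable A -> measurable B ->
  lebesgue_cons [set x | A (x ord0 ord0) /\
                         B (\row_(i < n) x ord0 (lift ord0 i))] =
  (lebesgue_measure A * m B)%E.
Proof.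
move=> mA mB; rewrite /lebesgue_cons /pushforward preimage_cons_rV.
exact: product_measure1E.
Qed.

Let lebesgue_cons_sigma_finite : sigma_finite setT lebesgue_cons.
Proof.
have /sigma_finiteP[F [FT ndF mF]] := sigma_finiteT m.
have /sigma_finiteP[H [HT ndH mH]] := sigma_finiteT (@lebesgue_measure R).
exists (fun k => [set x : 'rV[R]_n.+1 | H k (x ord0 ord0) /\
                          F k (\row_(i < n) x ord0 (lift ord0 i))]).
  apply/seteqP; split=> // x _.
  have [i _ Hi] : (\bigcup_i H i) (x ord0 ord0) by rewrite -HT.
  have [j _ Fj] : (\bigcup_j F j) (\row_(i < n) x ord0 (lift ord0 i)).
    by rewrite -FT.
  exists (maxn i j) => //; split.
    by move: Hi; apply/subsetPset/ndH/leq_maxl.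
  by move: Fj; apply/subsetPset/ndF/leq_maxr.
move=> k; have [mFk Fkoo] := mF k; have [mHk Hkoo] := mH k.
split; first exact: measurable_cons_rV_setX.
by rewrite lebesgue_cons_setX// lte_mul_pinfty// ge0_fin_numE.
Qed.

HB.instance Definition _ :=
  @Measure_isSigmaFinite.Build _ _ _ lebesgue_cons lebesgue_cons_sigma_finite.

End step.

Fixpoint lebesgue_rV n : {sigma_finite_measure set 'rV[R]_n -> \bar R} :=
  match n return {sigma_finite_measure set 'rV[R]_n -> \bar R} with
  | 0 => dirac (0 : 'rV[R]_0)
  | k.+1 => lebesgue_cons (lebesgue_rV k)
  end.

Lemma lebesgue_rV_box n (a b : 'rV[R]_n) :
  lebesgue_rV n [set x : 'rV[R]_n | forall i, x ord0 i \in `[a ord0 i, b ord0 i]] =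
  (\prod_(i < n) lebesgue_measure `[a ord0 i, b ord0 i])%E.
Proof.
suff [] : measurable [set x : 'rV[R]_n | forall i, x ord0 i \in `[a ord0 i, b ord0 i]] /\
    lebesgue_rV n [set x : 'rV[R]_n | forall i, x ord0 i \in `[a ord0 i, b ord0 i]] =
    (\prod_(i < n) lebesgue_measure `[a ord0 i, b ord0 i])%E by [].
elim: n a b => [|n IHn] a b.
  rewrite (_ : [set _ | _] = setT); last first.
    by apply/seteqP; split=> // x _ [].
  by rewrite big_ord0 /= diracT.
have [mB muB] := IHn (\row_i a ord0 (lift ord0 i)) (\row_i b ord0 (lift ord0 i)).
set B := (X in measurable X) in mB.
have -> : [set x : 'rV[R]_n.+1 | forall i, x ord0 i \in `[a ord0 i, b ord0 i]]
    = [set x | `[a ord0 ord0, b ord0 ord0]%classic (x ord0 ord0) /\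
               B (\row_(i < n) x ord0 (lift ord0 i))].
  apply/seteqP; split=> x /=.
    by move=> xab; split=> [|i]; rewrite ?mxE //; exact: xab.
  move=> [x0 xS] i; case: (unliftP ord0 i) => [j|] -> //.
  by have := xS j; rewrite !mxE.
split; first exact: measurable_cons_rV_setX.
rewrite [LHS]lebesgue_cons_setX// big_ord_recl; congr (_ * _)%E.
by rewrite [LHS]muB; apply: eq_bigr => i _; rewrite !mxE.
Qed.

End lebesgue_rV.

Section nonlocal_functionals.
Context (R : realType) (n : nat).
Local Notation V := 'rV[R]_n.
Local Notation lebV := (lebesgue_rV R n).
Local Notation leb1 := (@lebesgue_measure R).

Definition bounded_domain (Omega : set V) :=
  [/\ Omega !=set0, open Omega, connected Omega & bounded_set Omega].

Definition Qset (Omega : set V) : set (V * V) := ~` (~` Omega `*` ~` Omega).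

Implicit Types (G : V -> V -> R -> R -> R) (I : set R) (Omega : set V)
  (u : R -> V -> R) (w : V -> R) (A : set (V -> R)).

Definition d_a G x y a b : R := derive1 (fun a' => G x y a' b) a.
Definition d_b G x y a b : R := derive1 (fun b' => G x y a b') b.
Definition d_ab G x y a b : R := derive1 (fun b' => d_a G x y a b') b.

(* The derivatives in the statement exist: G(x,y,.,.) is C^1, and
   d_a G(x,y,a,.) is differentiable. This is required for all x and y: a kernel
   that is singular at x = y is to be given the value 0 there. *)
Definition differentiable_integrand G :=
  [/\ forall x y a b, derivable (fun a' => G x y a' b) a 1,
      forall x y a b, derivable (fun b' => G x y a b') b 1,
      forall x y, continuous (fun p : R * R => d_a G x y p.1 p.2),
      forall x y, continuous (fun p : R * R => d_b G x y p.1 p.2) &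
      forall x y a b, derivable (fun b' => d_a G x y a b') b 1].

Definition symmetric_integrand G := forall x y a b, G x y a b = G y x b a.

Definition elliptic G := forall x y a b, d_ab G x y a b <= 0.

(* Derivatives are taken within I, hence one-sided at endpoints lying in I. *)
Definition C1_on I (f : R -> R) := exists f' : R -> R,
  {within I, continuous f'} /\
  forall t, I t -> (f s - f t) / (s - t) @[s --> within I t^'] --> f' t.

Definition is_field I u :=
  [/\ {within [set p : V * R | I p.2], continuous (fun p => u p.2 p.1)},
      forall x, C1_on I (fun t => u t x) &
      forall x, {in I &, {homo (fun t => u t x) : s t / s < t}}].

Definition leaf_region I u : set (V * R) :=
  [set p | exists2 t, I t & p.2 = u t p.1].

(* Unspecified outside [leaf_region I u]. *)
Definition leaf_param I u x lambda : R := get [set t | I t /\ u t x = lambda].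

Definition energy G Omega w : R :=
  2^-1 * \int[(lebV \x lebV)%E]_(z in Qset Omega) G z.1 z.2 (w z.1) (w z.2).

Definition EL_operator G w x : R := \int[lebV]_y d_a G x y (w x) (w y).

Definition oriented_integral (a b : R) (f : R -> R) : R :=
  if a <= b then \int[leb1]_(s in `[a, b]) f s
  else - \int[leb1]_(s in `[b, a]) f s.

Definition leaf_density G I u x y lambda : R :=
  let t := leaf_param I u x lambda in d_a G x y (u t x) (u t y).

Definition calib_integrand G I u t0 w x y : R :=
  oriented_integral (u t0 x) (w x) (leaf_density G I u x y).

Definition calib_functional G Omega I u t0 w : R :=
  \int[(lebV \x lebV)%E]_(z in Qset Omega) calib_integrand G I u t0 w z.1 z.2
  + energy G Omega (u t0).

(* All integrals converge absolutely; the last clause is the hypothesis of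
   Fubini's theorem for the triple integral over x in Omega, y in R^n and
   lambda between u^s(x) and w(x). *)
Definition sufficiently_regular G Omega I u A :=
  [/\ forall w, A w -> measurable_fun [set: V] w,
      forall w, A w -> (lebV \x lebV)%E.-integrable (Qset Omega)
        (fun z => (G z.1 z.2 (w z.1) (w z.2))%:E),
      forall t x, I t -> Omega x -> lebV.-integrable [set: V]
        (fun y => (d_a G x y (u t x) (u t y))%:E),
      forall s w, I s -> A w -> (lebV \x lebV)%E.-integrable (Qset Omega)
        (fun z => (calib_integrand G I u s w z.1 z.2)%:E) &
      forall s w, I s -> A w -> ((lebV \x lebV) \x leb1)%E.-integrable
        [set p : V * V * R | Omega p.1.1 /\
           Num.min (u s p.1.1) (w p.1.1) <= p.2
             <= Num.max (u s p.1.1) (w p.1.1)]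
        (fun p => (leaf_density G I u p.1.1 p.1.2 p.2)%:E)].

Section calibrations.
Context (Omega : set V) (A : set (V -> R)).
Implicit Types E C : (V -> R) -> R.

Definition calibration E w0 C :=
  [/\ C w0 = E w0,
      forall w, A w -> {in ~` Omega, w =1 w0} -> C w <= E w &
      forall w, A w -> {in ~` Omega, w =1 w0} -> C w0 <= C w].

Definition null_lagrangian E w0 C :=
  [/\ C w0 = E w0,
      forall w, A w -> {in ~` Omega, w =1 w0} -> C w <= E w &
      forall w, A w -> {in ~` Omega, w =1 w0} -> C w0 = C w].

Definition minimizes E w0 :=
  A w0 /\ forall w, A w -> {in ~` Omega, w =1 w0} -> E w0 <= E w.

End calibrations.

End nonlocal_functionals.

(* Main.v *)
Require Import Defs.
From HB Require Import structures.
From mathcomp Require Import all_boot all_order all_algebra.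
From mathcomp Require Import all_classical all_reals all_analysis.
From mathcomp Require Import measurable_realfun.
From mathcomp Require Import ring lra.
Import Order.TTheory GRing.Theory Num.Theory.
Import numFieldNormedType.Exports.
Local Open Scope classical_set_scope.
Local Open Scope ring_scope.

(** Write [C] and [E] for the calibration functional and the energy.

    The inequality [C w <= E w] holds pointwise after symmetrization in [(x, y)]
    ([calib_integrand_sym_le]). Fix [x] and [y], and put [g = G x y],
    [phi t = u t x], [psi t = u t y], [w x = phi t1], [w y = psi t2]. By the
    symmetry of [G], the calibration integrands at [(x, y)] and [(y, x)] add up
    to the integral of [dg] along the curve [(phi, psi)], with the first
    coordinate stopped at the parameter [t1] and the second one at [t2]. If
    [t1 <= t2], the part of this integral up to [t1] is exactly
    [g (phi t1) (psi t1) - g (phi t0) (psi t0)] ([oriented_diagonal]); in the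
    remaining part the partial derivative of [g] in its second argument is
    evaluated along the curve instead of at [a = phi t1], and since it is
    nonincreasing in [a], by ellipticity, the result is at most
    [g (phi t1) (psi t2) - g (phi t1) (psi t1)]. The case [t2 <= t1] is
    symmetric.

    The exactness along the curve needs neither a change of variables nor a
    chain rule. The error in the identity over a parameter interval [[p, q]] is
    bounded by the second difference of [g] on the rectangle
    [[phi p, phi q] x [psi p, psi q]], because the derivatives along the curve
    lie between their values on opposite sides of the rectangle
    ([leaf_integral_bounds]). This second difference is [o(phi q - phi p)],
    so the error has zero derivative ([diagonal_integral]).

    For the comparison of [C (u t0)] with [C w], the calibration integrand
    vanishes off [Omega x R^n], because [w] is [u t0] outside [Omega]. By
    Fubini's theorem, for almost every [x] in [Omega] its integral in [y] is the
    oriented integral from [u t0 x] to [w x], in [lambda], of the Euler-Lagrange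
    operator, at [x], of the leaf through [(x, lambda)]
    ([calib_functional_fubini]). The parameter of this leaf is at least [t0] when
    [lambda >= u t0 x] and at most [t0] otherwise, so that the sign conditions
    make the oriented integral nonnegative, and it is zero for a field of
    extremals. Since the regularity hypotheses do not depend on [t0], the case
    of extremals applies to every leaf. *)

Set Implicit Arguments.
Unset Strict Implicit.

(** * Calculus on the real line *)

Section real_calculus.
Context {R : realType}.
Local Notation leb := (@lebesgue_measure R).

Lemma ndecr_derivable_ge0 (k dk : R -> R) (x : R) :
  (forall y : R, is_derive y 1 k (dk y)) -> {homo k : y z / y <= z} ->
  0 <= dk x.
Proof.
move=> hk knd; apply/ler_addgt0Pr => e e0.
(* Adding [e * z] makes [k] strictly increasing, as required by
   [incr_derive1_ge0]. *)
have hke (y : R) : is_derive y 1 (k \+ (fun z => e * z)) (dk y + e).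
  have hky := hk y.
  rewrite -[X in _ + X]mulr1; apply: is_deriveD.
have := @incr_derive1_ge0 _ (k \+ (fun z => e * z)) setT x.
rewrite derive1E (@derive_val _ _ _ _ _ _ _ (hke x)); apply.
- by move=> y _; case: (hke y).
- by move=> y z _ _ yz /=; rewrite ler_ltD ?knd ?(ltW yz)// ltr_pM2l.
- by rewrite interiorT.
Qed.

Lemma MVT_le (k dk : R -> R) (a b : R) : a <= b ->
  (forall y : R, is_derive y 1 k (dk y)) ->
  exists2 c, a <= c <= b & k b - k a = dk c * (b - a).
Proof.
move=> ab hk; have [|c cab ->] := @MVT_segment R k dk a b ab (fun x _ => hk x).
  by apply: derivable_within_continuous => y _; have [] := hk y.
by exists c => //; move: cab; rewrite in_itv.
Qed.

Lemma within_segment_integrable (f : R -> R) (a b : R) :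
  {within `[a, b], continuous f} -> leb.-integrable `[a, b] (EFin \o f).
Proof.
move=> cf; apply: continuous_compact_integrable => //; exact: segment_compact.
Qed.

Lemma Rintegral_FTC (k dk : R -> R) (a b : R) : a <= b ->
  (forall y : R, is_derive y 1 k (dk y)) -> continuous dk ->
  \int[leb]_(x in `[a, b]) dk x = k b - k a.
Proof.
rewrite le_eqVlt => /predU1P[<- _ _|ab hk cdk].
  by rewrite set_itv1 Rintegral_set1 subrr.
have ck : continuous k.
  move=> y; apply: differentiable_continuous; apply/derivable1_diffP.
  by have [] := hk y.
rewrite /Rintegral (@continuous_FTC2 _ dk k)//.
- exact: continuous_subspaceT.
- split; first by move=> y _; have [] := hk y.
  + exact/cvg_at_right_filter/ck.
  + exact/cvg_at_left_filter/ck.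
- by move=> y _; rewrite derive1E; have [] := hk y.
Qed.

Lemma Rintegral_segmentD (f : R -> R) (a b c : R) : a <= b -> b <= c ->
  leb.-integrable `[a, c] (EFin \o f) ->
  \int[leb]_(x in `[a, c]) f x =
  \int[leb]_(x in `[a, b]) f x + \int[leb]_(x in `[b, c]) f x.
Proof.
move=> ab bc intf.
rewrite -[RHS]addrC; apply/eqP; rewrite -subr_eq; apply/eqP.
rewrite (@Rintegral_itvB _ f (BLeft a) (BRight c) b)//.
rewrite Rintegral_itv_obnd_cbnd//.
by apply: integrableS intf => //; apply: subset_itvr; rewrite bnd_simp.
Qed.

Lemma oriented_integral_le (f : R -> R) (a b : R) : a <= b ->
  oriented_integral a b f = \int[leb]_(x in `[a, b]) f x.
Proof. by rewrite /oriented_integral => ->. Qed.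

Lemma oriented_integral_ge (f : R -> R) (a b : R) : b <= a ->
  oriented_integral a b f = - \int[leb]_(x in `[b, a]) f x.
Proof.
rewrite /oriented_integral => ba; case: ifPn => // ab.
have -> : a = b by apply/eqP; rewrite eq_le ab ba.
by rewrite set_itv1 Rintegral_set1 oppr0.
Qed.

Lemma oriented_integral_opp (f : R -> R) (a b : R) :
  oriented_integral a b f = - oriented_integral b a f.
Proof.
have [ab|/ltW ba] := leP a b.
  by rewrite oriented_integral_le// oriented_integral_ge// opprK.
by rewrite oriented_integral_ge// oriented_integral_le.
Qed.

(** Oriented integrals are differences of a primitive taken from a common lower
    endpoint; additivity then needs no case analysis on the order of the
    points. *)
Lemma oriented_integralB (f : R -> R) (m M a b : R) :
  leb.-integrable `[m, M] (EFin \o f) -> m <= a <= M -> m <= b <= M ->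
  oriented_integral a b f =
  \int[leb]_(x in `[m, b]) f x - \int[leb]_(x in `[m, a]) f x.
Proof.
move=> fmM /andP[ma aM] /andP[mb bM].
have sub x : x <= M -> leb.-integrable `[m, x] (EFin \o f).
  move=> xM; apply: integrableS fmM => //.
  by apply: subset_itvl; rewrite bnd_simp.
have [ab|/ltW ba] := leP a b.
- rewrite oriented_integral_le// (Rintegral_segmentD ma ab (sub _ bM)).
  by rewrite addrC addKr.
- rewrite oriented_integral_ge// (Rintegral_segmentD mb ba (sub _ aM)).
  by rewrite opprD addNKr.
Qed.

Lemma oriented_integralD (f : R -> R) (m M a b c : R) :
  leb.-integrable `[m, M] (EFin \o f) ->
  m <= a <= M -> m <= b <= M -> m <= c <= M ->
  oriented_integral a c f = oriented_integral a b f + oriented_integral b c f.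
Proof.
move=> fmM am bm cm.
rewrite (oriented_integralB fmM am cm) (oriented_integralB fmM am bm).
by rewrite (oriented_integralB fmM bm cm); ring.
Qed.

End real_calculus.

(** * Submodular functions of two real variables *)

Section two_variables.
Context {R : realType}.
Local Notation leb := (@lebesgue_measure R).
Implicit Types g ga gb : R -> R -> R.

(** [g] has continuous partial derivatives [ga] and [gb], and [ga a b] is
    nonincreasing in [b]: a form of [d_ab g <= 0] that only involves first
    derivatives and is invariant under exchange of the two variables
    ([submodular_C1_swap]). *)
Definition submodular_C1 g ga gb :=
  [/\ forall a b : R, is_derive a 1 (g^~ b) (ga a b),
      forall a b : R, is_derive b 1 (g a) (gb a b),
      continuous (fun p : R * R => ga p.1 p.2),
      continuous (fun p : R * R => gb p.1 p.2) &
      forall a, {homo ga a : b b' /~ b <= b'}].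

(** The second differences of [g] are nonpositive, so its increments in [b]
    decrease with [a]; hence so does [gb]. *)
Lemma submodular_C1_d2_dec g ga gb : submodular_C1 g ga gb ->
  forall b, {homo gb^~ b : a a' /~ a <= a'}.
Proof.
move=> [dga dgb _ _ ga_dec] b a' a aa'; rewrite -subr_ge0.
have dk (y : R) : is_derive y 1 (g a - g a') (gb a y - gb a' y).
  exact: (is_deriveB (dgb a y) (dgb a' y)).
apply: (@ndecr_derivable_ge0 _ _ (fun y => gb a y - gb a' y) b dk).
move=> y z yz; change (g a y - g a' y <= g a z - g a' z).
have dh (c : R) : is_derive c 1 (g^~ z - g^~ y) (ga c z - ga c y).
  exact: (is_deriveB (dga c z) (dga c y)).
have [c _ h] := MVT_le aa' dh.
have {}h : (g a' z - g a' y) - (g a z - g a y) =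
  (ga c z - ga c y) * (a' - a) := h.
have : (ga c z - ga c y) * (a' - a) <= 0.
  by rewrite mulr_le0_ge0 ?subr_le0 ?subr_ge0// ga_dec.
rewrite -h; lra.
Qed.

Lemma continuous_uncurry_swap (f : R -> R -> R) :
  continuous (fun p : R * R => f p.1 p.2) ->
  continuous (fun p : R * R => f p.2 p.1).
Proof.
move=> cf p; have cs : (q.2, q.1) @[q --> p] --> (p.2, p.1).
  exact: (cvg_pair cvg_snd cvg_fst).
exact: (cvg_comp _ _ cs (cf (p.2, p.1))).
Qed.

Lemma submodular_C1_swap g ga gb : submodular_C1 g ga gb ->
  submodular_C1 (fun b a => g a b) (fun b a => gb a b) (fun b a => ga a b).
Proof.
move=> Hg; have gb_dec := submodular_C1_d2_dec Hg.
case: Hg => dga dgb cga cgb ga_dec; split => //.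
- exact: continuous_uncurry_swap.
- exact: continuous_uncurry_swap.
Qed.

Lemma continuous_section1 (f : R -> R -> R) (b : R) :
  continuous (fun p : R * R => f p.1 p.2) -> continuous (f^~ b).
Proof.
move=> cf a; have cs : (x, b) @[x --> a] --> (a, b).
  exact: (cvg_pair cvg_id (cvg_cst b)).
exact: (cvg_comp _ _ cs (cf (a, b))).
Qed.

Lemma submodular_C1_FTC g ga gb (b c d : R) : submodular_C1 g ga gb -> c <= d ->
  leb.-integrable `[c, d] (EFin \o ga^~ b) /\
  \int[leb]_(l in `[c, d]) ga l b = g d b - g c b.
Proof.
move=> [dga _ cga _ _] cd; have cgb := continuous_section1 (b := b) cga; split.
  by apply: within_segment_integrable; exact: continuous_subspaceT.
by apply: Rintegral_FTC => // y; exact: dga.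
Qed.

(** The function [f] takes at [phi r] the value of [ga] at the point
    [(phi r, psi r)] of the curve. As [ga] is nonincreasing in its second
    argument, the integral of [f] lies between those of [ga] along the top and
    the bottom sides of the rectangle that the curve crosses. *)
Lemma leaf_integral_bounds g ga gb (phi psi f : R -> R) (p q : R) :
  submodular_C1 g ga gb -> phi p <= phi q ->
  (forall r, p <= r <= q -> psi p <= psi r <= psi q) ->
  (forall l, phi p <= l <= phi q ->
     exists2 r, p <= r <= q & phi r = l /\ f l = ga (phi r) (psi r)) ->
  leb.-integrable `[phi p, phi q] (EFin \o f) ->
  g (phi q) (psi q) - g (phi p) (psi q) <= \int[leb]_(l in `[phi p, phi q]) f l
    <= g (phi q) (psi p) - g (phi p) (psi p).
Proof.
move=> Hg pq psiM surj intf.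
have [i1 <-] := submodular_C1_FTC (psi p) Hg pq.
have [i2 <-] := submodular_C1_FTC (psi q) Hg pq.
case: Hg => _ _ _ _ ga_dec.
by apply/andP; split; apply: le_Rintegral => // l /=;
  rewrite in_itv/= => /surj[r /psiM/andP[? ?] [<- ->]]; exact: ga_dec.
Qed.

End two_variables.

(** The integral of [dg] along the curve [(phi, psi)], each coordinate being its
    own integration variable. Differentiability is needed for [phi] only. *)
Section diagonal.
Context {R : realType}.
Local Notation leb := (@lebesgue_measure R).
Variables (g ga gb : R -> R -> R) (s t : R) (phi psi f1 f2 : R -> R).
Hypothesis Hg : submodular_C1 g ga gb.
Hypothesis st : s <= t.
Hypothesis phi_mono : {in `[s, t] &, {homo phi : x y / x <= y}}.
Hypothesis psi_mono : {in `[s, t] &, {homo psi : x y / x <= y}}.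
Hypothesis cphi : {within `[s, t], continuous phi}.
Hypothesis cpsi : {within `[s, t], continuous psi}.
Hypothesis dphi : {in `]s, t[, forall r, derivable phi r 1}.
Hypothesis f1E : {in `[s, t], forall r, f1 (phi r) = ga (phi r) (psi r)}.
Hypothesis f2E : {in `[s, t], forall r, f2 (psi r) = gb (phi r) (psi r)}.
Hypothesis if1 : leb.-integrable `[phi s, phi t] (EFin \o f1).
Hypothesis if2 : leb.-integrable `[psi s, psi t] (EFin \o f2).

Let onto (h : R -> R) : {in `[s, t] &, {homo h : x y / x <= y}} ->
  {within `[s, t], continuous h} ->
  forall p q, p \in `[s, t] -> q \in `[s, t] -> p <= q ->
  forall l, h p <= l <= h q -> exists2 r, p <= r <= q & h r = l.
Proof.
move=> hm ch p q pI qI pq l lI.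
have [||r + <-] := @IVT R h p q l pq.
- apply: continuous_subspaceW ch => x /=; apply: subset_itv; rewrite bnd_simp.
    by rewrite (itvP pI).
  by rewrite (itvP qI).
- have hpq : h p <= h q by exact: hm.
  by rewrite (min_idPl _)// (max_idPr _).
by rewrite in_itv/= => rI; exists r.
Qed.

Let defect r := g (phi r) (psi r) - \int[leb]_(l in `[phi s, phi r]) f1 l -
  \int[leb]_(l in `[psi s, psi r]) f2 l.

Let sI : s \in `[s, t]. Proof. by rewrite bound_itvE. Qed.
Let tI : t \in `[s, t]. Proof. by rewrite bound_itvE. Qed.

(* The defect varies by at most the absolute value of the second difference of
   [g] on the rectangle [[phi p, phi q] x [psi p, psi q]]. *)
Let defectB p q : p \in `[s, t] -> q \in `[s, t] -> p <= q ->
  `|defect q - defect p| <= g (phi p) (psi q) + g (phi q) (psi p) -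
     g (phi q) (psi q) - g (phi p) (psi p).
Proof.
move=> pI qI pq.
have [sp qt] : s <= p /\ q <= t by rewrite (itvP pI) (itvP qI).
have sub r : p <= r <= q -> r \in `[s, t].
  by move=> /andP[pr rq]; rewrite in_itv/= (le_trans sp pr) (le_trans rq qt).
have i1 : leb.-integrable `[phi p, phi q] (EFin \o f1).
  by apply: integrableS if1 => //; apply: subset_itv; rewrite bnd_simp phi_mono.
have i2 : leb.-integrable `[psi p, psi q] (EFin \o f2).
  by apply: integrableS if2 => //; apply: subset_itv; rewrite bnd_simp psi_mono.
have i1' : leb.-integrable `[phi s, phi q] (EFin \o f1).
  by apply: integrableS if1 => //; apply: subset_itvl;
    rewrite bnd_simp phi_mono.
have i2' : leb.-integrable `[psi s, psi q] (EFin \o f2).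
  by apply: integrableS if2 => //; apply: subset_itvl;
    rewrite bnd_simp psi_mono.
have /andP[l1 u1] : g (phi q) (psi q) - g (phi p) (psi q) <=
     \int[leb]_(l in `[phi p, phi q]) f1 l <=
     g (phi q) (psi p) - g (phi p) (psi p).
  apply: (leaf_integral_bounds Hg) => //; first exact: phi_mono.
    move=> r pr; have rI := sub r pr; case/andP: pr => pr rq.
    by rewrite !psi_mono.
  move=> l /(onto phi_mono cphi pI qI pq)[r pr <-].
  by exists r => //; rewrite f1E ?sub.
have /andP[l2 u2] : g (phi q) (psi q) - g (phi q) (psi p) <=
     \int[leb]_(l in `[psi p, psi q]) f2 l <=
     g (phi p) (psi q) - g (phi p) (psi p).
  apply: (leaf_integral_bounds (submodular_C1_swap Hg)) => //.
    exact: psi_mono.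
    move=> r pr; have rI := sub r pr; case/andP: pr => pr rq.
    by rewrite !phi_mono.
  move=> l /(onto psi_mono cpsi pI qI pq)[r pr <-].
  by exists r => //; rewrite f2E ?sub.
rewrite /defect (Rintegral_segmentD (b := phi p) _ _ i1') ?phi_mono//.
rewrite (Rintegral_segmentD (b := psi p) _ _ i2') ?psi_mono//.
by rewrite ler_norml; apply/andP; split; lra.
Qed.

(* By the mean value theorem in the first variable, the second difference is
   [(phi q - phi p) * (ga c (psi p) - ga c (psi q))], and the second factor is
   small by continuity of [ga]. *)
Let defect_small p e : p \in `[s, t] -> 0 < e ->
  \forall q \near within `[s, t] (nbhs p),
    `|defect q - defect p| <= e * `|phi q - phi p|.
Proof.
move=> pI e0.
have [dga _ cga _ _] := Hg.
have e20 : 0 < e / 2 by rewrite divr_gt0.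
have := cga (phi p, psi p) => /cvgrPdist_lt/(_ _ e20).
move=> -[[U V] /= [/nbhs_ballP[d1 /= d10 dU] /nbhs_ballP[d2 /= d20 dV]] UV].
have close a b : `|phi p - a| < d1 -> `|psi p - b| < d2 ->
    `|ga (phi p) (psi p) - ga a b| < e / 2.
  by move=> ha hb; apply: (UV (a, b)); split; [exact: dU|exact: dV].
have /subspace_continuousP/(_ p pI)/cvgrPdist_lt/(_ _ d10) n1 := cphi.
have /subspace_continuousP/(_ p pI)/cvgrPdist_lt/(_ _ d20) n2 := cpsi.
near=> q.
have qI : q \in `[s, t].
  by near: q; exact: withinT.
have h1 : `|phi p - phi q| < d1 by near: q.
have h2 : `|psi p - psi q| < d2 by near: q.
have bnd : `|defect q - defect p| <= g (phi p) (psi q) + g (phi q) (psi p) -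
     g (phi q) (psi q) - g (phi p) (psi p).
  have [pq|/ltW qp] := leP p q; first exact: defectB.
  by rewrite distrC; have := defectB qI pI qp; lra.
apply: (le_trans bnd).
have dk (a : R) : is_derive a 1 (g^~ (psi p) - g^~ (psi q))
    (ga a (psi p) - ga a (psi q)).
  exact: (is_deriveB (dga a (psi p)) (dga a (psi q))).
have main c : `|phi p - c| <= `|phi p - phi q| ->
    `|ga c (psi p) - ga c (psi q)| <= e.
  move=> hc; have hc1 : `|phi p - c| < d1 by exact: le_lt_trans h1.
  have ep : `|ga (phi p) (psi p) - ga c (psi p)| < e / 2.
    by apply: close => //; rewrite subrr normr0.
  have eq := close c (psi q) hc1 h2.
  by move: ep eq; rewrite !ltr_norml ler_norml => /andP[? ?] /andP[? ?]; lra.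
have [pq|/ltW qp] := leP (phi p) (phi q).
- have [c /andP[pc cq] h] := MVT_le pq dk.
  have {}h : (g (phi q) (psi p) - g (phi q) (psi q)) -
    (g (phi p) (psi p) - g (phi p) (psi q)) =
    (ga c (psi p) - ga c (psi q)) * (phi q - phi p) := h.
  apply: (@le_trans _ _ ((ga c (psi p) - ga c (psi q)) * (phi q - phi p))).
    by rewrite -h; lra.
  apply: (le_trans (ler_norm _)); rewrite normrM ler_wpM2r// main//.
  by rewrite distrC [leRHS]distrC !ger0_norm ?subr_ge0// lerB.
- have [c /andP[qc cp] h] := MVT_le qp dk.
  have {}h : (g (phi p) (psi p) - g (phi p) (psi q)) -
    (g (phi q) (psi p) - g (phi q) (psi q)) =
    (ga c (psi p) - ga c (psi q)) * (phi p - phi q) := h.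
  apply: (@le_trans _ _ ((ga c (psi p) - ga c (psi q)) * (phi q - phi p))).
    rewrite -(opprB (phi p)) mulrN -h; lra.
  apply: (le_trans (ler_norm _)); rewrite normrM ler_wpM2r// main//.
  by rewrite !ger0_norm ?subr_ge0// lerB.
Unshelve. all: by end_near. Qed.

Lemma diagonal_integral :
  \int[leb]_(l in `[phi s, phi t]) f1 l +
    \int[leb]_(l in `[psi s, psi t]) f2 l =
  g (phi t) (psi t) - g (phi s) (psi s).
Proof.
suff : defect t = defect s.
  by rewrite /defect !set_itv1 !Rintegral_set1; lra.
have cdefect : {within `[s, t], continuous defect}.
  apply/subspace_continuousP => p pI; apply/cvgrPdist_le => e e0.
  have /subspace_continuousP/(_ p pI)/cvgrPdist_le/(_ _ e0) n1 := cphi.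
  near=> q; rewrite distrC.
  apply: (@le_trans _ _ (1 * `|phi q - phi p|)); last first.
    by rewrite mul1r distrC; near: q.
  by near: q; exact: defect_small.
have ddefect (r : R) : r \in `]s, t[ -> is_derive r 1 defect 0.
  move=> rI.
  have rI' : r \in `[s, t] by apply: subset_itv_oo_cc.
  have := dphi rI; rewrite /derivable => /cvg_ex[/= l dl].
  suff cl : h^-1 *: ((defect \o shift r) (h *: 1) - defect r) @[h --> 0^']
      --> (0 : R).
    by apply: DeriveDef; [exact: cvgP cl|exact: cvg_lim cl].
  apply/cvgrPdist_le => e e0.
  (* The difference quotients of [phi] are eventually bounded by [`|l| + 1]. *)
  have L0 : 0 < `|l| + 1 by rewrite ltr_wpDl.
  have eL : 0 < e / (`|l| + 1) by rewrite divr_gt0.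
  have := defect_small rI' eL.
  rewrite within_interior; last by rewrite interior_itv.
  move=> n1.
  have n2 : \forall h \near 0^', `|defect (h + r) - defect r| <=
      e / (`|l| + 1) * `|phi (h + r) - phi r|.
    have : (h + r) @[h --> (0 : R)] --> r.
      rewrite -[X in _ --> X]add0r.
      by apply: cvgD; [exact: cvg_id|exact: cvg_cst].
    move=> /(_ _ n1) n1'; exact: nbhs_dnbhs n1'.
  have /cvgrPdist_lt/(_ _ ltr01) n3 := dl.
  near=> h.
  rewrite sub0r normrN normrZ /= [h *: 1]mulr1.
  have b2 : `|defect (h + r) - defect r| <=
      e / (`|l| + 1) * `|phi (h + r) - phi r| by near: h.
  have b3 : `|l - h^-1 *: (phi (h *: 1 + r) - phi r)| < 1 by near: h.
  have {}b3 : `|h^-1| * `|phi (h + r) - phi r| <= `|l| + 1.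
    rewrite -normrM; move: b3; rewrite [h *: 1]mulr1 /= => b3.
    rewrite -[X in `|X|](subKr l) (le_trans (ler_normB _ _))//.
    by rewrite lerD2l ltW.
  apply: (@le_trans _ _ (`|h^-1| * (e / (`|l| + 1) * `|phi (h + r) - phi r|))).
    by rewrite ler_wpM2l.
  rewrite mulrCA -[leRHS](@divfK _ (`|l| + 1)) ?gt_eqF//.
  by rewrite ler_wpM2l// ltW.
have [->//|snt] := eqVneq s t.
have slt : s < t by rewrite lt_neqAle snt.
have [c _] := MVT slt ddefect cdefect.
by rewrite mul0r => /eqP; rewrite subr_eq0 => /eqP.
Unshelve. all: by end_near. Qed.
End diagonal.

(** * Increasing curves parametrized by an interval *)

Section leaf_curve.
Context {R : realType}.
Local Notation leb := (@lebesgue_measure R).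
Variable I : set R.
Hypothesis itvI : is_interval I.

(** The regularity in [t] of a field at a fixed point [x]. Differentiability is
    only required in the interior of [I], where derivatives are two-sided. *)
Definition increasing_curve (phi : R -> R) :=
  [/\ {in I &, {homo phi : x y / x < y}}, {within I, continuous phi} &
      forall r, I° r -> derivable phi r 1].

Lemma interval_segment p q : I p -> I q -> `[p, q] `<=` I.
Proof.
move=> Ip Iq x /=; rewrite in_itv/= => xpq; exact: (itvI Ip Iq xpq).
Qed.

Lemma interval_segment_in p q x : I p -> I q -> x \in `[p, q] -> x \in I.
Proof. by move=> Ip Iq xpq; rewrite inE; exact: (interval_segment Ip Iq). Qed.

Lemma curve_mono phi : increasing_curve phi ->
  {in I &, {homo phi : x y / x <= y}}.
Proof. by move=> [h _ _]; apply: ltW_homo_in. Qed.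

Lemma curve_onto phi p q l : increasing_curve phi -> I p -> I q -> p <= q ->
  phi p <= l <= phi q -> exists2 r, p <= r <= q & phi r = l.
Proof.
move=> cur Ip Iq pq lI; have := cur => -[_ cphi _].
have [||r + <-] := @IVT R phi p q l pq.
- exact: continuous_subspaceW (interval_segment Ip Iq) cphi.
- have hpq : phi p <= phi q by apply: (curve_mono cur); rewrite ?inE.
  by rewrite (min_idPl _)// (max_idPr _).
by rewrite in_itv/= => rI; exists r.
Qed.

(** [tau] is the leaf-parameter function. It is continuous as the inverse of an
    increasing continuous function on a segment, hence so is [f]. *)
Lemma leaf_integrand_integrable (phi psi tau f : R -> R) (k : R -> R -> R) p q :
  increasing_curve phi -> increasing_curve psi ->
  continuous (fun p : R * R => k p.1 p.2) ->
  {in I, cancel phi tau} ->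
  (forall r, I r -> f (phi r) = k (phi r) (psi r)) ->
  I p -> I q -> leb.-integrable `[phi p, phi q] (EFin \o f).
Proof.
move=> Hphi Hpsi ck tauK fE Ip Iq.
have [qp|pq] := ltP q p.
  rewrite set_itv_ge; last first.
    by rewrite bnd_simp -ltNge; case: Hphi => + _ _; apply; rewrite ?inE.
  exact: integrable_set0.
have [_ cphi _] := Hphi; have [_ cpsi _] := Hpsi.
have seg := interval_segment Ip Iq.
have ctau : {within `[phi p, phi q], continuous tau}.
  apply: segment_can_le_continuous => //.
    exact: continuous_subspaceW cphi.
  by move=> r rpq; rewrite tauK// inE; exact: seg.
have tauP l : `[phi p, phi q]%classic l ->
    `[p, q]%classic (tau l) /\ phi (tau l) = l.
  rewrite /= in_itv/= => /(curve_onto Hphi Ip Iq pq)[r rpq <-].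
  by rewrite tauK// inE; apply: seg; rewrite /= in_itv.
apply: within_segment_integrable; apply/subspace_continuousP => l lI.
have [tl pl] := tauP l lI.
have fl l' : `[phi p, phi q]%classic l' -> f l' = k l' (psi (tau l')).
  by move=> /tauP[tl' pl']; rewrite -{1}pl' fE ?pl'//; exact: seg.
suff : f l' @[l' --> within `[phi p, phi q] (nbhs l)] --> f l by [].
rewrite (fl _ lI).
have c1 : psi (tau l') @[l' --> within `[phi p, phi q] (nbhs l)]
    --> psi (tau l).
  have /subspace_continuousP/(_ _ (seg _ tl)) := cpsi.
  apply: cvg_comp => A nA.
  have /subspace_continuousP/(_ _ lI)/(_ _ nA) := ctau.
  by apply: filterS2 (withinT _ _) => l' /tauP[/seg tl' _]; apply.
have c2 : (l', psi (tau l')) @[l' --> within `[phi p, phi q] (nbhs l)]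
    --> (l, psi (tau l)).
  have c0 : l' @[l' --> within `[phi p, phi q] (nbhs l)] --> l.
    exact: cvg_within.
  exact: (cvg_pair c0 c1).
have := cvg_comp _ _ c2 (ck (l, psi (tau l))).
apply: cvg_trans; apply: near_eq_cvg.
by apply: filterS (withinT _ _) => l' /fl ->.
Qed.

Section pair.
Variables (g ga gb : R -> R -> R) (phi psi f1 f2 : R -> R).
Hypothesis Hg : submodular_C1 g ga gb.
Hypothesis Hphi : increasing_curve phi.
Hypothesis Hpsi : increasing_curve psi.
Hypothesis f1E : forall r, I r -> f1 (phi r) = ga (phi r) (psi r).
Hypothesis f2E : forall r, I r -> f2 (psi r) = gb (phi r) (psi r).
Hypothesis if1 : forall p q, I p -> I q ->
  leb.-integrable `[phi p, phi q] (EFin \o f1).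
Hypothesis if2 : forall p q, I p -> I q ->
  leb.-integrable `[psi p, psi q] (EFin \o f2).

Lemma oriented_diagonal p q : I p -> I q ->
  oriented_integral (phi p) (phi q) f1 + oriented_integral (psi p) (psi q) f2 =
  g (phi q) (psi q) - g (phi p) (psi p).
Proof.
have m1 := curve_mono Hphi; have m2 := curve_mono Hpsi.
have [[_ cphi dphi] [_ cpsi _]] := (Hphi, Hpsi).
wlog pq : p q / p <= q.
  move=> key Ip Iq; have [|/ltW qp] := leP p q; first by move/key; apply.
  have := key _ _ qp Iq Ip; rewrite (oriented_integral_opp _ (phi q)).
  by rewrite (oriented_integral_opp _ (psi q)); lra.
move=> Ip Iq; have seg := interval_segment Ip Iq.
have segin := interval_segment_in Ip Iq.
rewrite !oriented_integral_le ?m1 ?m2 ?inE//.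
apply: (@diagonal_integral _ g ga gb p q phi psi f1 f2) => //.
- by move=> x y xI yI; apply: m1; exact: segin.
- by move=> x y xI yI; apply: m2; exact: segin.
- exact: continuous_subspaceW cphi.
- exact: continuous_subspaceW cpsi.
- move=> r rI; apply: dphi; apply: (interiorS seg).
  by rewrite interior_itv.
- by move=> r /segin; rewrite inE => /f1E.
- by move=> r /segin; rewrite inE => /f2E.
- exact: if1.
- exact: if2.
Qed.

End pair.

(** Splitting the second integral at [psi t1] leaves the exact integral up to
    [t1] and a remainder on which [gb] is evaluated at [phi r >= phi t1]. *)
Lemma curve_pair_ineq_le (g ga gb : R -> R -> R) (phi psi f1 f2 : R -> R)
    t0 t1 t2 :
  submodular_C1 g ga gb -> increasing_curve phi -> increasing_curve psi ->
  (forall r, I r -> f1 (phi r) = ga (phi r) (psi r)) ->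
  (forall r, I r -> f2 (psi r) = gb (phi r) (psi r)) ->
  (forall p q, I p -> I q -> leb.-integrable `[phi p, phi q] (EFin \o f1)) ->
  (forall p q, I p -> I q -> leb.-integrable `[psi p, psi q] (EFin \o f2)) ->
  I t0 -> I t1 -> I t2 -> t1 <= t2 ->
  oriented_integral (phi t0) (phi t1) f1 +
    oriented_integral (psi t0) (psi t2) f2 <=
  g (phi t1) (psi t2) - g (phi t0) (psi t0).
Proof.
move=> Hg Hphi Hpsi f1E f2E if1 if2 I0 I1 I2 t12.
have m1 := curve_mono Hphi; have m2 := curve_mono Hpsi.
have Imin : I (Num.min t0 t1) by rewrite /Num.min; case: ifP.
have Imax : I (Num.max t0 t2) by rewrite /Num.max; case: ifP.
have bd r : Num.min t0 t1 <= r <= Num.max t0 t2 -> I r ->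
    psi (Num.min t0 t1) <= psi r <= psi (Num.max t0 t2).
  by move=> /andP[? ?] Ir; rewrite !m2 ?inE.
rewrite (oriented_integralD (b := psi t1) (if2 _ _ Imin Imax)); last 3 first.
- by apply: bd => //; rewrite ge_min le_max lexx.
- by apply: bd => //; rewrite ge_min le_max lexx t12 !orbT.
- by apply: bd => //; rewrite ge_min le_max lexx t12 !orbT.
rewrite addrA (oriented_diagonal Hg Hphi Hpsi f1E f2E)//.
suff : oriented_integral (psi t1) (psi t2) f2 <=
  g (phi t1) (psi t2) - g (phi t1) (psi t1) by lra.
rewrite oriented_integral_le ?m2 ?inE//.
have /andP[_ ->//] : g (phi t2) (psi t2) - g (phi t2) (psi t1) <=
   \int[leb]_(l in `[psi t1, psi t2]) f2 l <=
   g (phi t1) (psi t2) - g (phi t1) (psi t1).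
apply: (leaf_integral_bounds (submodular_C1_swap Hg)) => //.
- by rewrite m2 ?inE.
- move=> r r12; have Ir : I r := itvI I1 I2 r12.
  by case/andP: r12 => r1 r2; rewrite !m1 ?inE.
- move=> l /(curve_onto Hpsi I1 I2 t12)[r r12 <-].
  by exists r => //; rewrite f2E//; exact: itvI r12.
- exact: if2.
Qed.

Lemma curve_pair_ineq (g ga gb : R -> R -> R) (phi psi f1 f2 : R -> R)
    t0 t1 t2 :
  submodular_C1 g ga gb -> increasing_curve phi -> increasing_curve psi ->
  (forall r, I r -> f1 (phi r) = ga (phi r) (psi r)) ->
  (forall r, I r -> f2 (psi r) = gb (phi r) (psi r)) ->
  (forall p q, I p -> I q -> leb.-integrable `[phi p, phi q] (EFin \o f1)) ->
  (forall p q, I p -> I q -> leb.-integrable `[psi p, psi q] (EFin \o f2)) ->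
  I t0 -> I t1 -> I t2 ->
  oriented_integral (phi t0) (phi t1) f1 +
    oriented_integral (psi t0) (psi t2) f2 <=
  g (phi t1) (psi t2) - g (phi t0) (psi t0).
Proof.
move=> Hg Hphi Hpsi f1E f2E if1 if2 I0 I1 I2.
have [t12|/ltW t21] := leP t1 t2; first exact: (curve_pair_ineq_le Hg).
by rewrite addrC; apply: (curve_pair_ineq_le (submodular_C1_swap Hg)).
Qed.

End leaf_curve.

(** * The pointwise calibration inequality *)

Section pointwise.
Context {R : realType} {n : nat}.
Local Notation V := 'rV[R]_n.
Local Notation leb := (@lebesgue_measure R).
Variables (I : set R) (G : V -> V -> R -> R -> R) (u : R -> V -> R).
Hypothesis itvI : is_interval I.
Hypothesis hu : is_field I u.

Lemma field_curve x : increasing_curve I (fun t => u t x).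
Proof.
have [cu du mu] := hu; split; first exact: mu.
- apply/subspace_continuousP => t It.
  have /subspace_continuousP/(_ (x, t) It) cut := cu.
  suff c : (x, s) @[s --> within I (nbhs t)] -->
      within [set p : V * R | I p.2] (nbhs (x, t)).
    exact: (cvg_comp _ _ c cut).
  move=> A [[B C] /= [nB nC] BC].
  apply: filterS nC => s Cs Is; apply: (BC (x, s)) => //; split => //=.
  exact: nbhs_singleton.
- move=> t It; have [f' [_ /(_ t (interior_subset It)) dt]] := du x.
  have sh : (h + t) @[h --> (0 : R)^'] --> within I t^'.
    move=> A; rewrite /within /= => nA.
    have c0 : (h + t) @[h --> (0 : R)] --> t.
      rewrite -[X in _ --> X]add0r.
      by apply: cvgD; [exact: cvg_id|exact: cvg_cst].
    have nI : nbhs t I by exact: It.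
    change (\forall h \near (0 : R)^', A (h + t)).
    have nA' : nbhs t (fun s => s != t -> I s -> A s) by exact: nA.
    near=> h.
    have hI : I (h + t) by near: h; apply: nbhs_dnbhs; exact: c0 nI.
    have : h + t != t.
      by rewrite -subr_eq0 addrK; near: h; exact: nbhs_dnbhs_neq.
    suff : h + t != t -> I (h + t) -> A (h + t) by move=> H /H; apply.
    by near: h; apply: nbhs_dnbhs; exact: c0 nA'.
  suff : h^-1 *: (((u^~ x) \o shift t) (h *: 1) - u t x) @[h --> (0 : R)^']
      --> f' t by exact: cvgP.
  have := cvg_comp _ _ sh dt; apply: cvg_trans; apply: near_eq_cvg.
  near=> h => /=.
  by rewrite addrK [h *: 1]mulr1 mulrC.
Unshelve. all: by end_near. Qed.

Lemma leaf_param_leaf t x : I t -> leaf_param I u x (u t x) = t.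
Proof.
move=> It; have [_ _ mu] := hu.
have : [set s | I s /\ u s x = u t x] (leaf_param I u x (u t x)).
  by apply: getPex; exists t.
move=> [Is]; set s := leaf_param _ _ _ _ in Is * => sE.
have [st|ts|//] := ltgtP s t.
- by have := mu x s t; rewrite !inE => /(_ Is It st); rewrite /= sE ltxx.
- by have := mu x t s; rewrite !inE => /(_ It Is ts); rewrite /= sE ltxx.
Qed.

Lemma leaf_density_leaf x y t : I t ->
  leaf_density G I u x y (u t x) = d_a G x y (u t x) (u t y).
Proof. by move=> It; rewrite /leaf_density leaf_param_leaf. Qed.

Hypothesis hG : differentiable_integrand G.

Lemma leaf_density_integrable x y s t : I s -> I t ->
  leb.-integrable `[u s x, u t x] (EFin \o leaf_density G I u x y).
Proof.
move=> Is It; have [_ _ cda _ _] := hG.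
apply: (leaf_integrand_integrable itvI (field_curve x) (field_curve y) (cda x y)
  (tau := leaf_param I u x)) => //.
- by move=> r; rewrite inE => /leaf_param_leaf.
- by move=> r; exact: leaf_density_leaf.
Qed.

Hypothesis Gsym : symmetric_integrand G.
Hypothesis Gell : elliptic G.

Lemma elliptic_submodular x y : submodular_C1 (G x y) (d_a G x y) (d_b G x y).
Proof.
have [dGa dGb cda cdb dGab] := hG; split => //.
- by move=> a b; apply: DeriveDef; [exact: dGa|rewrite /d_a derive1E].
- by move=> a b; apply: DeriveDef; [exact: dGb|rewrite /d_b derive1E].
- move=> a b' b bb'.
  have dd (c : R) : is_derive c 1 (d_a G x y a) (d_ab G x y a c).
    by apply: DeriveDef; [exact: dGab|rewrite /d_ab derive1E].
  have [c _ h] := MVT_le bb' dd.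
  by rewrite -subr_le0 h mulr_le0_ge0 ?subr_ge0//; exact: Gell.
Qed.

Lemma symmetric_d_a x y a b : d_a G y x b a = d_b G x y a b.
Proof.
rewrite /d_a /d_b; congr (derive1 _ b); apply/funext => b'; exact: Gsym.
Qed.

(** The pointwise form of [C w <= E w], up to the factor [2] of the
    symmetrization. *)
Lemma calib_integrand_sym_le t0 (w : V -> R) x y : I t0 ->
  leaf_region I u (x, w x) -> leaf_region I u (y, w y) ->
  calib_integrand G I u t0 w x y + calib_integrand G I u t0 w y x <=
  G x y (w x) (w y) - G x y (u t0 x) (u t0 y).
Proof.
move=> It0 [t1 It1 /= wx] [t2 It2 /= wy].
rewrite /calib_integrand wx wy.
apply: (@curve_pair_ineq _ I itvI _ _ _ (fun t => u t x) (fun t => u t y) _ _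
  t0 t1 t2 (elliptic_submodular x y) (field_curve x) (field_curve y)) => //.
- by move=> r; exact: leaf_density_leaf.
- by move=> r Ir; rewrite leaf_density_leaf// symmetric_d_a.
- by move=> *; exact: leaf_density_integrable.
- by move=> *; exact: leaf_density_integrable.
Qed.

End pointwise.

(** * Measurability and product integrals *)

(** The sigma-algebra on row vectors is generated by the coordinates, so that
    the measurability of open sets has to be derived: an open set is the union
    of the countably many rational boxes that it contains. *)
Section measurable_open_rV.
Context {R : realType} {n : nat}.

Let box (q : 'rV[rat]_n * nat) : set 'rV[R]_n :=
  [set x | forall i, ball (ratr (q.1 ord0 i) : R) q.2.+1%:R^-1 (x ord0 i)].

Let measurable_box q : measurable (box q).
Proof.
have -> : box q = \bigcap_(i in [set: 'I_n])
    [set x | ball (ratr (q.1 ord0 i) : R) q.2.+1%:R^-1 (x ord0 i)].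
  by apply/seteqP; split=> x h i => [_|]; exact: h.
apply: fin_bigcap_measurable => [|i _]; first exact: finite_finset.
rewrite -[X in measurable X]setTI.
by apply: measurable_coord => //; exact: measurable_realfun.measurable_ball.
Qed.

Lemma open_measurable_rV (O : set 'rV[R]_n) : open O -> measurable O.
Proof.
move=> oO.
have -> : O = \bigcup_(q : {q : 'rV[rat]_n * nat | `[< box q `<=` O >]})
    box (sval q).
  apply/seteqP; split => [x Ox|x [[q /asboolP /= h] _ /=]]; last exact: h.
  have /nbhs_ballP[e /= e0 eO] : nbhs x O by exact: open_nbhs_nbhs.
  have [k /= ke] : exists k : nat, 2 * k.+1%:R^-1 < e.
    have [|k ?] := @ltr_add_invr R 0 (e / 2); first by rewrite divr_gt0.
    by exists k; rewrite mulrC -ltr_pdivlMr// -[X in X < _]add0r.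
  pose r : R := k.+1%:R^-1.
  rewrite -/r in ke; have r0 : 0 < r by rewrite invr_gt0 ltr0n.
  have ex (i : 'I_n) : exists c : rat, ball (ratr c : R) r (x ord0 i).
    have /rat_in_itvoo[c] : x ord0 i - r < x ord0 i + r by lra.
    rewrite in_itv/= => /andP[? ?]; exists c.
    by rewrite /ball /= ltr_norml; apply/andP; split; lra.
  have /choice[c hc] := ex.
  pose q : 'rV[rat]_n * nat := (\row_i c i, k).
  have qO : `[< box q `<=` O >].
    apply/asboolP => y hy; apply: eO; split => // i j.
    have -> : i = ord0 by exact: ord1.
    have := hy j; have := hc j; rewrite /q mxE /= -/r.
    rewrite /ball /= !ltr_norml => /andP[? ?] /andP[? ?].
    by apply/andP; split; lra.
  exists (exist _ q qO) => //= i; rewrite mxE; exact: hc.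
apply: countable_bigcupT_measurable => // q; exact: measurable_box.
Qed.

End measurable_open_rV.

Section product_integrals.
Local Open Scope ereal_scope.
Context {R : realType}.

Lemma integral_le0 d (T : measurableType d) (mu : {measure set T -> \bar R})
  (f : T -> \bar R) : (forall x, f x <= 0) -> \int[mu]_x f x <= 0.
Proof.
move=> f0; rewrite integralE integral0_eq; last first.
  by move=> x _; rewrite funeposE; apply/max_idPr; exact: f0.
by rewrite sub0e oppe_le0 integral_ge0.
Qed.

Lemma integrable_swap d (T : measurableType d)
    (m : {sigma_finite_measure set T -> \bar R}) (f : T * T -> \bar R) :
  (m \x m).-integrable setT f ->
  (m \x m).-integrable setT (fun z => f (z.2, z.1)) /\
  \int[m \x m]_z f (z.2, z.1) = \int[m \x m]_z f z.
Proof.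
move=> intf; have mf : measurable_fun setT f by exact: measurable_int intf.
have mfs : measurable_fun setT (fun z => f (z.2, z.1)).
  by apply: (measurableT_comp mf); exact: measurable_swap.
have intfs : (m \x m).-integrable setT (fun z => f (z.2, z.1)).
  by apply/(integrable21ltyP _ _ mfs)/(integrable12ltyP _ _ mf).
split => //; rewrite -(integral21_prod_meas1 intfs).
by rewrite -(integral12_prod_meas1 intf).
Qed.

Lemma Rintegral_swap d (T : measurableType d)
    (m : {sigma_finite_measure set T -> \bar R}) (D : set (T * T))
    (f : T * T -> R) : measurable D -> (forall z, D z -> D (z.2, z.1)) ->
  (m \x m).-integrable D (EFin \o f) ->
  (m \x m).-integrable D (EFin \o (fun z => f (z.2, z.1))) /\
  (\int[m \x m]_(z in D) f (z.2, z.1) = \int[m \x m]_(z in D) f z)%R.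
Proof.
move=> mD symD /(integrable_mkcond _ mD)/integrable_swap[].
have E : (fun z => ((EFin \o f) \_ D) (z.2, z.1)) =
    (EFin \o (fun z => f (z.2, z.1))) \_ D.
  apply/funext => -[x y]; rewrite !patchE /=.
  have -> : ((y, x) \in D) = ((x, y) \in D).
    by apply/idP/idP; rewrite !inE => /symD.
  by [].
rewrite E => i1 i2; split; first exact/(integrable_mkcond _ mD).
by rewrite /Rintegral integral_mkcond i2 -integral_mkcond.
Qed.

Lemma sigma_finite_product d1 d2 (T1 : measurableType d1)
    (T2 : measurableType d2) (m1 : {sigma_finite_measure set T1 -> \bar R})
    (m2 : {sigma_finite_measure set T2 -> \bar R}) :
  sigma_finite setT (m1 \x m2).
Proof.
have /sigma_finiteP[F [FT ndF mF]] := sigma_finiteT m1.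
have /sigma_finiteP[H [HT ndH mH]] := sigma_finiteT m2.
exists (fun k => F k `*` H k) => [|k].
  apply/seteqP; split => // -[x y] _.
  have [i _ Fi] : (\bigcup_i F i) x by rewrite -FT.
  have [j _ Hj] : (\bigcup_j H j) y by rewrite -HT.
  exists (maxn i j) => //; split => /=.
    exact: (subsetPset _ _ (ndF _ _ (leq_maxl i j))).
  exact: (subsetPset _ _ (ndH _ _ (leq_maxr i j))).
have [[mFk Fk] [mHk Hk]] := (mF k, mH k); split; first exact: measurableX.
by rewrite product_measure1E// lte_mul_pinfty// ge0_fin_numE.
Qed.

(** The product measure bundled with its sigma-finiteness, so that it can serve
    as a factor of a further product. *)
Definition product_sigma_finite d1 d2 (T1 : measurableType d1)
    (T2 : measurableType d2) (m1 : {sigma_finite_measure set T1 -> \bar R})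
    (m2 : {sigma_finite_measure set T2 -> \bar R}) :
    {sigma_finite_measure set (T1 * T2)%type -> \bar R} :=
  HB.pack (m1 \x m2) (Measure_isSigmaFinite.Build _ _ _ (m1 \x m2)
    (sigma_finite_product m1 m2)).

(** For almost every first coordinate, the slice of a function integrable on the
    triple product is integrable on the product of the last two factors, so that
    Fubini's theorem applies to it. *)
Lemma ae_integrable_slice d1 d2 d3 (T1 : measurableType d1)
    (T2 : measurableType d2) (T3 : measurableType d3)
    (m1 : {sigma_finite_measure set T1 -> \bar R})
    (m2 : {sigma_finite_measure set T2 -> \bar R})
    (m3 : {sigma_finite_measure set T3 -> \bar R})
    (f : T1 * T2 * T3 -> \bar R) :
  ((m1 \x m2) \x m3).-integrable setT f ->
  {ae m1, forall x, (m2 \x m3).-integrable setT (fun q => f (x, q.1, q.2))}.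
Proof.
move=> intf; have mf : measurable_fun setT f by exact: measurable_int intf.
have ia : ((m1 \x m2) \x m3).-integrable setT (abse \o f).
  exact: integrable_abse.
have iF : (m1 \x m2).-integrable setT (fubini_F m3 (abse \o f)).
  exact: (@integrable_fubini_F _ _ _ _ _ (product_sigma_finite m1 m2) m3 _ ia).
apply: filterS (ae_integrable1 iF) => x /integrableP[_ ix].
have mfx : measurable_fun setT (fun q : T2 * T3 => f (x, q.1, q.2)).
  apply: (measurableT_comp mf); apply: measurable_fun_pair => //.
  exact: measurable_fun_pair.
apply/(integrable12ltyP _ _ mfx); apply: le_lt_trans ix.
rewrite le_eqVlt; apply/orP; left; apply/eqP; apply: eq_integral => y _.
rewrite gee0_abs; first by [].
by apply: integral_ge0 => z _ /=; exact: abse_ge0.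
Qed.

End product_integrals.

(** * The calibration functional *)

Section calibration_proof.
Context {R : realType} {n : nat}.
Local Notation V := 'rV[R]_n.
Local Notation lebV := (lebesgue_rV R n).
Local Notation leb1 := (@lebesgue_measure R).
Variables (I : set R) (Omega : set V) (G : V -> V -> R -> R -> R)
  (u : R -> V -> R) (A : set (V -> R)).
Hypothesis hI : is_interval I.
Hypothesis mO : measurable Omega.
Hypothesis hG : differentiable_integrand G.
Hypothesis hu : is_field I u.
Hypothesis hAu : forall t, I t -> A (u t).
Hypothesis hAgraph : forall w, A w -> forall x, leaf_region I u (x, w x).
Hypothesis hreg : sufficiently_regular G Omega I u A.

Lemma measurable_Qset : measurable (Qset Omega).
Proof. by apply: measurableC; apply: measurableX; apply: measurableC. Qed.

Lemma calib_integrand_leaf t x y : calib_integrand G I u t (u t) x y = 0.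
Proof.
by rewrite /calib_integrand oriented_integral_le// set_itv1 Rintegral_set1.
Qed.

Lemma calib_functional_leaf t :
  calib_functional G Omega I u t (u t) = energy G Omega (u t).
Proof.
rewrite /calib_functional (_ : \int[_]_(z in _) _ = 0) ?add0r//.
rewrite /Rintegral integral0_eq// => z _.
by rewrite calib_integrand_leaf.
Qed.

Lemma calib_functional_le_energy (Gsym : symmetric_integrand G)
    (Gell : elliptic G) t w : I t -> A w ->
  calib_functional G Omega I u t w <= energy G Omega w.
Proof.
have half (a b c : R) : c + c <= a - b -> c + 2^-1 * b <= 2^-1 * a by lra.
move=> It Aw; have [_ iG _ ici _] := hreg.
have mQ := measurable_Qset.
have iw := iG _ Aw; have iu := iG _ (hAu It); have ic := ici _ _ It Aw.
have [ics swap] := @Rintegral_swap _ _ _ lebV (Qset Omega)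
  (fun z => calib_integrand G I u t w z.1 z.2) mQ
  (fun z Qz => fun h => Qz (conj h.2 h.1)) ic.
have eB := RintegralB mQ iw iu.
have eD := etrans (RintegralD mQ ic ics) (congr1 (fun v => _ + v) swap).
have iD := integrableD mQ ic ics.
have iB := integrableB mQ iw iu.
(* Integrating the pointwise inequality over the symmetric set [Qset Omega]
   doubles the integral of the calibration integrand. *)
have le := le_Rintegral mQ iD iB (fun z _ =>
  calib_integrand_sym_le hI hu hG Gsym Gell It
    (hAgraph Aw z.1) (hAgraph Aw z.2)).
rewrite eD eB in le; rewrite /calib_functional /energy.
exact: half le.
Qed.

(** The difference between [calib_functional] at [w] and the energy of [u t0],
    computed with [w] equal to [u t0] outside [Omega]. *)
Section slices.
Variables (t0 : R) (w : V -> R).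
Hypothesis It0 : I t0.
Hypothesis Aw : A w.
Hypothesis w_out : forall x, ~ Omega x -> w x = u t0 x.

Let lo x := Num.min (u t0 x) (w x).
Let hi x := Num.max (u t0 x) (w x).
Let sgn x : R := if u t0 x <= w x then 1 else -1.

Let band := [set p : V * V * R | Omega p.1.1 /\ lo p.1.1 <= p.2 <= hi p.1.1].

(* The integrand of the triple integral, extended by zero off its domain. *)
Let F := (fun p : V * V * R => leaf_density G I u p.1.1 p.1.2 p.2) \_ band.

(* Lebesgue measure lives on [measurableTypeR R], whose measurable sets are
   those of [R] under another display. *)
Let measurable_band : measurable (band : set (V * V * measurableTypeR R)).
Proof.
have [mA _ _ _ _] := hreg.
have mu0 := mA _ (hAu It0); have mw := mA _ Aw.
pose p11 (p : V * V * measurableTypeR R) := p.1.1.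
have m11 : measurable_fun [set: V * V * measurableTypeR R] p11.
  exact: (measurableT_comp measurable_fst measurable_fst).
have mlo : measurable_fun [set: V * V * measurableTypeR R] (lo \o p11).
  by apply: (measurableT_comp _ m11); exact: measurable_minr.
have mhi : measurable_fun [set: V * V * measurableTypeR R] (hi \o p11).
  by apply: (measurableT_comp _ m11); exact: measurable_maxr.
have m2 : measurable_fun [set: V * V * measurableTypeR R]
    (fun p : V * V * measurableTypeR R => p.2 : R) by exact: measurable_snd.
have -> : band = (p11 @^-1` Omega) `&`
    ([set p | lo (p11 p) <= p.2] `&` [set p | p.2 <= hi (p11 p)]).
  apply/seteqP; split=> p /=; first by move=> [? /andP[? ?]].
  by move=> [? [? ?]]; split => //; apply/andP.
apply: measurableI; first by rewrite -[X in measurable X]setTI; exact: m11.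
apply: measurableI; rewrite -[X in measurable X]setTI; exact: measurable_fun_le.
Qed.

Let sliceE x y l : Omega x ->
  F (x, y, l) = (leaf_density G I u x y \_ `[lo x, hi x]) l.
Proof.
move=> Ox; rewrite /F !patchE.
suff -> : ((x, y, l) \in band) = (l \in `[lo x, hi x]%classic) by [].
by apply/idP/idP; rewrite !inE /band /= in_itv/=; [case|move=> ?; split].
Qed.

Let slice_out x y l : ~ Omega x -> F (x, y, l) = 0.
Proof.
by move=> Ox; rewrite /F patchE ifF//; apply/negP; rewrite inE => -[].
Qed.

(* The leaf through a point between the graphs of [u t0] and [w] exists, and it
   lies on the same side of [u t0] as [w] does at [x]. *)
Let leaf_between x l : lo x <= l <= hi x ->
  exists2 t, I t & u t x = l /\ (if u t0 x <= w x then t0 <= t else t <= t0).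
Proof.
have [t1 It1 /= wx] := hAgraph Aw x.
have cur := field_curve hu x.
have [mu _ _] := cur.
rewrite /lo /hi; have [ab|ba] := leP (u t0 x) (w x).
- have t01 : t0 <= t1.
    rewrite leNgt; apply/negP => t10; have := mu t1 t0.
    by rewrite !inE => /(_ It1 It0 t10); rewrite -wx ltNge ab.
  rewrite wx => /(curve_onto hI cur It0 It1 t01)[r rI <-].
  by exists r; [exact: hI rI|split => //; case/andP: rI].
- have t10 : t1 <= t0.
    rewrite leNgt; apply/negP => t01; have := mu t0 t1.
    by rewrite !inE => /(_ It0 It1 t01); rewrite -wx ltNge (ltW ba).
  rewrite wx => /(curve_onto hI cur It1 It0 t10)[r rI <-].
  by exists r; [exact: hI rI|split => //; case/andP: rI].
Qed.

(* The orientation of the integral is the factor [sgn x], which does not depend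
   on [y]. *)
Let calib_slice x y :
  ((EFin \o (fun z => calib_integrand G I u t0 w z.1 z.2)) \_ (Qset Omega))
    (x, y) =
  ((sgn x)%:E * \int[leb1]_l (F (x, y, l))%:E)%E.
Proof.
have [Ox|Ox] := pselect (Omega x).
- rewrite patchE ifT; last by rewrite inE => -[].
  have -> : (\int[leb1]_l (F (x, y, l))%:E =
      \int[leb1]_(l in `[lo x, hi x]) (leaf_density G I u x y l)%:E)%E.
    rewrite [RHS]integral_mkcond; apply: eq_integral => l _.
    by rewrite sliceE// !patchE; case: ifP.
  have [t1 It1 /= wx] := hAgraph Aw x.
  rewrite /= /calib_integrand /sgn /oriented_integral /lo /hi.
  have [ab|ba] := leP (u t0 x) (w x).
  + rewrite mul1e fineK//; apply: integrable_fin_num => //.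
    by rewrite wx; exact: leaf_density_integrable.
  + rewrite EFinN mulN1e fineK//; apply: integrable_fin_num => //.
    by rewrite wx; exact: leaf_density_integrable.
- rewrite integral0_eq ?mule0; last by move=> l _; rewrite slice_out.
  rewrite patchE; case: ifP => // _.
  rewrite /= /calib_integrand w_out// oriented_integral_le//.
  by rewrite set_itv1 Rintegral_set1.
Qed.

Let EL_slice x l : Omega x -> lo x <= l <= hi x ->
  exists2 t, I t & (if u t0 x <= w x then t0 <= t else t <= t0) /\
    (\int[lebV]_y (F (x, y, l))%:E = (EL_operator G (u t) x)%:E)%E.
Proof.
move=> Ox lI; have [t It [tl tt]] := leaf_between lI; subst l.
have [_ _ iEL _ _] := hreg.
exists t => //; split => //; rewrite /EL_operator /Rintegral fineK; last first.
  by apply: integrable_fin_num => //; exact: iEL.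
apply: eq_integral => y _; rewrite sliceE// patchE ifT ?leaf_density_leaf//.
by rewrite inE /= in_itv.
Qed.

Let integrable_F : ((lebV \x lebV) \x leb1)%E.-integrable setT (EFin \o F).
Proof.
have [_ _ _ _ idens] := hreg.
rewrite /F -restrict_EFin.
exact: ((integrable_mkcond _ measurable_band).1 (idens _ _ It0 Aw)).
Qed.

Let J := fubini_F lebV
  ((EFin \o (fun z => calib_integrand G I u t0 w z.1 z.2)) \_ (Qset Omega)).

Let J_slice : {ae lebV, forall x,
  J x = ((sgn x)%:E * \int[leb1]_l \int[lebV]_y (F (x, y, l))%:E)%E}.
Proof.
apply: filterS (ae_integrable_slice integrable_F) => x ix.
rewrite -(Fubini ix) /J /fubini_F.
under eq_integral do rewrite calib_slice.
rewrite integralZl//; exact: (integrable_fubini_F ix).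
Qed.

(** The witness [J x] is the integral in [y] of the calibration integrand over
    the section of [Qset Omega] at [x]. *)
Lemma calib_functional_fubini : exists J : V -> \bar R,
  [/\ lebV.-integrable setT J,
      calib_functional G Omega I u t0 w =
        fine (\int[lebV]_x J x)%E + energy G Omega (u t0),
      ((forall t x, I t -> t0 <= t -> Omega x -> 0 <= EL_operator G (u t) x) ->
       (forall t x, I t -> t <= t0 -> Omega x -> EL_operator G (u t) x <= 0) ->
       {ae lebV, forall x, (0 <= J x)%E}) &
      ((forall t x, I t -> Omega x -> EL_operator G (u t) x = 0) ->
       {ae lebV, forall x, J x = 0%E})].
Proof.
have [_ _ _ ici _] := hreg; have mQ := measurable_Qset.
have ic := (integrable_mkcond _ mQ).1 (ici _ _ It0 Aw).
have out x l : ~ (Omega x /\ lo x <= l <= hi x) ->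
    (\int[lebV]_y (F (x, y, l))%:E = 0)%E.
  move=> h; apply: integral0_eq => y _; rewrite /F patchE ifF//.
  by apply/negP; rewrite inE.
exists J; split.
- exact: integrable_fubini_F ic.
- rewrite /calib_functional; congr (_ + _); rewrite /Rintegral; congr fine.
  by rewrite integral_mkcond (integral12_prod_meas1 ic).
- move=> ge le; apply: filterS J_slice => x ->.
  rewrite /sgn; case: ifPn => ab.
  + rewrite mul1e; apply: integral_ge0 => l _.
    have [[Ox lI]|/out ->//] := pselect (Omega x /\ lo x <= l <= hi x).
    have [t It] := EL_slice Ox lI; rewrite ab => -[tt ->].
    by rewrite lee_fin ge.
  + rewrite EFinN mulN1e oppe_ge0; apply: integral_le0 => l.
    have [[Ox lI]|/out ->//] := pselect (Omega x /\ lo x <= l <= hi x).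
    have [t It] := EL_slice Ox lI; rewrite (negbTE ab) => -[tt ->].
    by rewrite lee_fin le.
- move=> EL0; apply: filterS J_slice => x ->.
  rewrite integral0_eq ?mule0// => l _.
  have [[Ox lI]|/out ->//] := pselect (Omega x /\ lo x <= l <= hi x).
  by have [t It [_ ->]] := EL_slice Ox lI; rewrite EL0.
Qed.

End slices.

Lemma calib_functional_ge t w : I t -> A w -> {in ~` Omega, w =1 u t} ->
  (forall s x, I s -> t <= s -> Omega x -> 0 <= EL_operator G (u s) x) ->
  (forall s x, I s -> s <= t -> Omega x -> EL_operator G (u s) x <= 0) ->
  calib_functional G Omega I u t (u t) <= calib_functional G Omega I u t w.
Proof.
move=> It Aw wu ge le.
have [|J [iJ -> /(_ ge le) J0 _]] := @calib_functional_fubini t w It Aw.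
  by move=> x Ox; apply: wu; rewrite inE.
rewrite calib_functional_leaf lerDr fine_ge0//.
have mJ : measurable_fun setT J by exact: measurable_int iJ.
(* [J] equals its absolute value almost everywhere. *)
rewrite (ae_eq_integral (abse \o J))//.
- by apply: integral_ge0 => x _; exact: abse_ge0.
- exact: measurableT_comp.
- by apply: filterS J0 => x Jx _; rewrite /= gee0_abs.
Qed.

Lemma calib_functional_eq t w : I t -> A w -> {in ~` Omega, w =1 u t} ->
  (forall s x, I s -> Omega x -> EL_operator G (u s) x = 0) ->
  calib_functional G Omega I u t (u t) = calib_functional G Omega I u t w.
Proof.
move=> It Aw wu EL0.
have [|J [iJ -> _ /(_ EL0) J0]] := @calib_functional_fubini t w It Aw.
  by move=> x Ox; apply: wu; rewrite inE.
have mJ : measurable_fun setT J by exact: measurable_int iJ.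
rewrite calib_functional_leaf (ae_eq_integral (cst 0%E))//.
- by rewrite integral0_eq// add0r.
- by apply: filterS J0 => x Jx _; rewrite Jx.
Qed.

End calibration_proof.

Unset Implicit Arguments.
Set Strict Implicit.

Theorem theorem1p3 (R : realType) (n : nat) (I : set R)
    (Omega : set 'rV[R]_n)
    (G : 'rV[R]_n -> 'rV[R]_n -> R -> R -> R)
    (u : R -> 'rV[R]_n -> R) (A : set ('rV[R]_n -> R)) (t0 : R)
    (hI : is_interval I)
    (hOmega : bounded_domain Omega)
    (hGdiff : differentiable_integrand G)
    (hGsym : symmetric_integrand G)
    (hGell : elliptic G)
    (hu : is_field I u)
    (hAu : forall t, I t -> A (u t))
    (hAgraph : forall w, A w -> forall x, leaf_region I u (x, w x))
    (hreg : sufficiently_regular G Omega I u A)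
    (ht0 : I t0) :
  let E := energy G Omega in
  let C := calib_functional G Omega I u t0 in
  [/\ (* (a) *)
      C (u t0) = E (u t0) /\
      (forall w, A w -> {in ~` Omega, w =1 u t0} -> C w <= E w),
      (* (b) *)
      (forall t x, I t -> t0 <= t -> Omega x -> 0 <= EL_operator G (u t) x) ->
      (forall t x, I t -> t <= t0 -> Omega x -> EL_operator G (u t) x <= 0) ->
      [/\ forall w, A w -> {in ~` Omega, w =1 u t0} -> C (u t0) <= C w,
          calibration Omega A E (u t0) C &
          minimizes Omega A E (u t0)] &
      (* (c) *)
      (forall t x, I t -> Omega x -> EL_operator G (u t) x = 0) ->
      [/\ forall w, A w -> {in ~` Omega, w =1 u t0} -> C (u t0) = C w,
          null_lagrangian Omega A E (u t0) C &
          forall t, I t -> minimizes Omega A E (u t)]].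
Proof.
have [_ oOmega _ _] := hOmega.
have mO := open_measurable_rV oOmega.
have CE t : I t -> calib_functional G Omega I u t (u t) = energy G Omega (u t).
  by move=> _; exact: calib_functional_leaf.
have leE t w : I t -> A w ->
    calib_functional G Omega I u t w <= energy G Omega w.
  exact: (calib_functional_le_energy hI mO hGdiff hu hAu hAgraph hreg hGsym
    hGell).
have geC := calib_functional_ge hI mO hGdiff hu hAu hAgraph hreg.
have eqC := calib_functional_eq hI mO hGdiff hu hAu hAgraph hreg.
move=> E C; split.
- by split=> [|w Aw _]; [exact: CE|exact: leE].
- move=> ge le.
  have min w : A w -> {in ~` Omega, w =1 u t0} -> C (u t0) <= C w.
    by move=> Aw wu; exact: geC.
  split=> //.
  + by split=> // [|w Aw _]; [exact: CE|exact: leE].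
  + split=> [|w Aw wu]; first exact: hAu.
    by rewrite /E -CE// (le_trans (min w Aw wu))// leE.
- move=> EL0.
  have eq t w : I t -> A w -> {in ~` Omega, w =1 u t} ->
      calib_functional G Omega I u t (u t) = calib_functional G Omega I u t w.
    by move=> It Aw wu; exact: eqC.
  split=> [w Aw wu||t It].
  + exact: eq.
  + by split=> [|w Aw _|w Aw wu]; [exact: CE|exact: leE|exact: eq].
  + split=> [|w Aw wu]; first exact: hAu.
    by rewrite /E -CE// (eq t w)// leE.
Qed.
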